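(* For all $n,k,r\in\mathbb{N}\cup\{0\}$ with $n\geq k$, we have $$T_r(n+r,k+r)=\sum_{l=k}^n\binom{n}{l}T(l,k)\,r^{n-l}.$$
   Context: Central factorials: $x^{[0]}=1$ and, for $n\ge 1$, $x^{[n]}=x\prod_{j=1}^{n-1}\left(x+\frac n2-j\right)=x\left(x+\frac n2-1\right)\left(x+\frac n2-2\right)\cdots\left(x-\frac n2+1\right)$. The central factorial numbers of the second kind $T(n,k)$ ($0\le k\le n$) are defined by $x^n=\sum_{k=0}^n T(n,k)x^{[k]}$ for all $n\ge 0$; equivalently (well known), by the formal power series identity $\frac{1}{k!}\left(e^{t/2}-e^{-t/2}\right)^k=\sum_{n=k}^\infty T(n,k)\frac{t^n}{n!}$ for $k\ge 0$. For a nonnegative integer $r$, the extended $r$-central factorial numbers of the second kind $T_r(n+r,k+r)$ ($n\ge k\ge 0$) are defined by the formal power series identity $$\frac{1}{k!}e^{rt}\left(e^{t/2}-e^{-t/2}\right)^k=\sum_{n=k}^\infty T_r(n+r,k+r)\frac{t^n}{n!},\qquad k\ge 0.$$ Convention: $0^0=1$. *)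

(* Defs.v *)
From HB Require Import structures.
From mathcomp Require Import all_boot all_order all_algebra.
From mathcomp Require Import zify.

Set Implicit Arguments.
Unset Strict Implicit.
Unset Printing Implicit Defensive.

Import Order.TTheory GRing.Theory Num.Theory.
Local Open Scope ring_scope.

(* The central factorial x^{[n]}, as a polynomial in x. *)
Definition central_fact (n : nat) : {poly rat} :=
  if n is 0%N then 1
  else 'X * \prod_(1 <= j < n) ('X + (n%:R / 2%:R - j%:R)%:P).

Lemma central_fact_monic_size n :
  (central_fact n \is monic) && (size (central_fact n) == n.+1).
Proof.
case: n => [|n]; first by rewrite /= monic1 size_poly1.
rewrite /central_fact.
set F := fun j : nat => 'X + (n.+1%:R / 2%:R - j%:R : rat)%:P.
have FE j : F j = 'X - (- (n.+1%:R / 2%:R - j%:R))%:P by rewrite polyCN opprK.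
have monF m : \prod_(1 <= j < m) F j \is monic.
  by apply: monic_prod => j _; rewrite FE monicXsubC.
have szF m : size (\prod_(1 <= j < m.+1) F j) = m.+1.
  elim: m => [|m IHm]; first by rewrite big_nil size_poly1.
  rewrite big_nat_recr //= FE size_Mmonic ?monicXsubC ?monic_neq0 //.
  by rewrite IHm size_XsubC addn2.
rewrite monicMl ?monicX // monF /=.
by rewrite mulrC size_mulX ?monic_neq0 // szF.
Qed.

Lemma central_fact_coefn n : (central_fact n)`_n = 1.
Proof.
have /andP[/monicP <- /eqP sz] := central_fact_monic_size n.
by rewrite lead_coefE sz.
Qed.

Lemma central_fact_span n (p : {poly rat}) : (size p <= n)%N ->
  exists c : 'rV[rat]_n, p == \sum_(k < n) c 0 k *: central_fact k.
Proof.
elim: n p => [|n IHn] p.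
  by rewrite leqn0 size_poly_eq0 => /eqP->; exists 0; rewrite big_ord0.
move=> szp; have /andP[_ /eqP sz] := central_fact_monic_size n.
have [|c /eqP Ec] := IHn (p - p`_n *: central_fact n).
  apply/leq_sizeP => j; rewrite leq_eqVlt => /predU1P[<-|ltnj].
    by rewrite coefB coefZ central_fact_coefn mulr1 subrr.
  rewrite coefB coefZ (nth_default _ (leq_trans szp ltnj)).
  by rewrite [(central_fact n)`_j]nth_default ?sz // mulr0 subr0.
exists (\row_k (if insub (val k) is Some i then c 0 i else p`_n)).
rewrite big_ord_recr /= mxE insubF ?ltnn //= -subr_eq Ec; apply/eqP.
by apply: eq_bigr => i _; rewrite mxE /= valK.
Qed.

(* T(n, k): the coordinates of x^n in the family x^{[0]}, ..., x^{[n]}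
   (central_fn2E and central_fn2_unique), and 0 for k > n. *)
Definition central_coords (n : nat) : 'rV[rat]_n.+1 :=
  xchoose (@central_fact_span n.+1 'X^n (eq_leq (size_polyXn rat n))).

Definition central_fn2 (n k : nat) : rat :=
  if insub k is Some i then central_coords n 0 i else 0.

Lemma central_fn2E n :
  'X^n = \sum_(k < n.+1) central_fn2 n k *: central_fact k.
Proof.
have /eqP E :=
  xchooseP (@central_fact_span n.+1 'X^n (eq_leq (size_polyXn rat n))).
by rewrite {1}E; apply: eq_bigr => i _; rewrite /central_fn2 valK.
Qed.

Lemma central_fact_free n (c : nat -> rat) :
  \sum_(k < n) c k *: central_fact k = 0 -> forall k, (k < n)%N -> c k = 0.
Proof.
elim: n => [//|n IHn]; rewrite big_ord_recr /= => E.
have cn0 : c n = 0.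
  move/(congr1 (fun p : {poly rat} => p`_n)): E.
  rewrite coefD coefZ coef_sum big1 => [|i _]; last first.
    have /andP[_ /eqP szi] := central_fact_monic_size i.
    by rewrite coefZ [(central_fact i)`_n]nth_default ?mulr0 // szi.
  by rewrite central_fact_coefn mulr1 add0r coef0.
move: E; rewrite cn0 scale0r addr0 => /IHn H k; rewrite ltnS leq_eqVlt.
by case/predU1P => [->|/H].
Qed.

Lemma central_fn2_unique (T : nat -> nat -> rat) :
  (forall n, 'X^n = \sum_(k < n.+1) T n k *: central_fact k) ->
  forall n k, (k <= n)%N -> T n k = central_fn2 n k.
Proof.
move=> TE n k lekn; apply/eqP; rewrite -subr_eq0; apply/eqP.
apply: (@central_fact_free n.+1 (fun k => T n k - central_fn2 n k)) => //.
under eq_bigr do rewrite scalerBl.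
by rewrite sumrB -TE -central_fn2E subrr.
Qed.

(* A formal power series in t over rat is its sequence of coefficients. *)
Definition fps := nat -> rat.

Definition fps_one : fps := fun n => (n == 0%N)%:R.
Definition fps_sub (f g : fps) : fps := fun n => f n - g n.
Definition fps_scale (c : rat) (f : fps) : fps := fun n => c * f n.
Definition fps_mul (f g : fps) : fps :=
  fun n => \sum_(i < n.+1) f i * g (n - i)%N.
Definition fps_pow (f : fps) (k : nat) : fps := iter k (fps_mul f) fps_one.

(* e^{ct} *)
Definition fps_exp (c : rat) : fps := fun n => c ^+ n / n`!%:R.

(* (1/k!) e^{rt} (e^{t/2} - e^{-t/2})^k *)
Definition r_central_egf (r k : nat) : fps :=
  fps_scale (k`!%:R)^-1
    (fps_mul (fps_exp r%:R)
       (fps_pow (fps_sub (fps_exp 2%:R^-1) (fps_exp (- 2%:R^-1))) k)).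

(* T_r(m, j), for r <= j <= m: the arguments are the shifted ones, m = n + r
   and j = k + r; values outside this range are junk.
   r_central_egfE is the generating function identity with sum from n = k. *)
Definition r_central_fn2 (r m j : nat) : rat :=
  (m - r)%N`!%:R * r_central_egf r (j - r)%N (m - r)%N.

Lemma fps_pow_low (f : fps) k n : f 0%N = 0 -> (n < k)%N -> fps_pow f k n = 0.
Proof.
move=> f0; elim: k n => [//|k IHk] n ltnk /=.
rewrite /fps_mul big1 // => -[[|i] /= ltin] _; first by rewrite f0 mul0r.
by rewrite IHk ?mulr0 //; lia.
Qed.

Lemma r_central_egfE r k n :
  r_central_egf r k n =
  if (k <= n)%N then r_central_fn2 r (n + r)%N (k + r)%N / n`!%:R else 0.
Proof.
have [lekn|ltnk] := leqP k n.
  rewrite /r_central_fn2 !addnK mulrAC divff ?mul1r //.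
  by rewrite pnatr_eq0 -lt0n fact_gt0.
rewrite /r_central_egf /fps_scale /fps_mul big1 ?mulr0 // => i _.
by rewrite fps_pow_low ?mulr0 //; last exact: leq_ltn_trans (leq_subr _ _) ltnk.
Qed.

(* Main.v *)
Require Import Defs.
From HB Require Import structures.
From mathcomp Require Import all_boot all_order all_algebra.
From mathcomp Require Import ring.

(* A power series g acts on polynomials by X^n |-> n! g_n. Under this pairing,
   multiplying g by e^{ct} is adjoint to the translation p(x) |-> p(x + c), so
   multiplying by e^{t/2} - e^{-t/2} is adjoint to the central difference
   operator delta. Since delta x^{[m]} = m x^{[m-1]}, the series
   (e^{t/2} - e^{-t/2})^k pairs with x^{[m]} to k! if m = k and to 0 otherwise,
   hence with x^l to k! T(l, k). The theorem is then the adjunction for e^{rt}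
   applied to x^n, followed by the binomial expansion of (x + r)^n. *)

Import GRing.Theory Num.Theory.

Local Open Scope ring_scope.

Definition fps_pair (g : fps) (p : {poly rat}) : rat :=
  \sum_(i < size p) p`_i * (i`!%:R * g i).

(** Coefficients beyond the size are 0. A common bound [N] lets polynomials of different sizes be
    paired over one range, as linearity requires. *)
Lemma fps_pairE (g : fps) (p : {poly rat}) N : (size p <= N)%N ->
  fps_pair g p = \sum_(i < N) p`_i * (i`!%:R * g i).
Proof.
move=> leN; rewrite /fps_pair.
rewrite (big_ord_widen _ (fun i => p`_i * (i`!%:R * g i)) leN).
rewrite [RHS](bigID (fun i : 'I_N => (i < size p)%N)) /= [X in _ + X]big1 ?addr0 //.
by move=> i; rewrite -leqNgt => lei; rewrite nth_default // mul0r.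
Qed.

Lemma fps_pair_is_linear (g : fps) : linear_for *%R (fps_pair g).
Proof.
move=> a p q; set N := maxn (size p) (size q).
have leN : (size (a *: p + q)%R <= N)%N.
  rewrite (leq_trans (size_polyD _ _)) // geq_max leq_maxr andbT.
  by rewrite (leq_trans (size_scale_leq _ _)) ?leq_maxl.
rewrite (fps_pairE g _ _ leN) (fps_pairE g p N) ?leq_maxl //.
rewrite (fps_pairE g q N) ?leq_maxr //.
rewrite mulr_sumr -big_split /=; apply: eq_bigr => i _.
by rewrite coefD coefZ mulrDl mulrA.
Qed.

HB.instance Definition _ (g : fps) :=
  GRing.isLinear.Build rat {poly rat} rat _ (fps_pair g) (fps_pair_is_linear g).

Lemma fps_pairXn (g : fps) n : fps_pair g 'X^n = n`!%:R * g n.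
Proof.
rewrite /fps_pair size_polyXn big_ord_recr /= coefXn eqxx mul1r big1 ?add0r //.
by move=> i _; rewrite coefXn ltn_eqF ?mul0r.
Qed.

Lemma fps_pair_one (p : {poly rat}) : fps_pair fps_one p = p`_0.
Proof.
rewrite (fps_pairE fps_one p (size p).+1) // big_ord_recl /= /fps_one !mulr1.
by rewrite big1 ?addr0 // => i _; rewrite !mulr0.
Qed.

Lemma fps_pair_mul_subl (a b g : fps) (p : {poly rat}) :
  fps_pair (fps_mul (fps_sub a b) g) p =
  fps_pair (fps_mul a g) p - fps_pair (fps_mul b g) p.
Proof.
rewrite /fps_pair -sumrB; apply: eq_bigr => i _; rewrite -!mulrBr /fps_mul.
by rewrite -sumrB; congr (_ * (_ * _)); apply: eq_bigr => j _; rewrite -mulrBl.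
Qed.

(** The two sums agree term by term, since n!/i! = C(n,i) (n-i)!. *)
Lemma fps_pair_exp_mulXn (c : rat) (g : fps) n :
  fps_pair (fps_mul (fps_exp c) g) 'X^n = fps_pair g (('X + c%:P) ^+ n).
Proof.
rewrite fps_pairXn exprDn linear_sum mulr_sumr; apply: eq_bigr => i _ /=.
have lein : (i <= n)%N by rewrite -ltnS.
rewrite -polyC_exp [_ * _%:P]mulrC mul_polyC linearMn linearZ_LR /= fps_pairXn.
rewrite /fps_exp -(bin_fact lein) !natrM -mulr_natl.
have := fact_gt0 i; rewrite lt0n -(pnatr_eq0 rat) => i0.
by field.
Qed.

Lemma fps_pair_exp_mul (c : rat) (g : fps) (p : {poly rat}) :
  fps_pair (fps_mul (fps_exp c) g) p = fps_pair g (p \Po ('X + c%:P)).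
Proof.
rewrite -[in LHS](coefK p) poly_def comp_polyE !linear_sum.
by apply: eq_bigr => i _; rewrite !linearZ_LR /= fps_pair_exp_mulXn.
Qed.

Definition central_diff (p : {poly rat}) : {poly rat} :=
  (p \Po ('X + (2%:R^-1)%:P)) - (p \Po ('X + (- 2%:R^-1)%:P)).

Lemma central_diff_fact0 : central_diff (central_fact 0) = 0.
Proof. by rewrite /central_diff /= -polyC1 !comp_polyC subrr. Qed.

Lemma central_diff_factS m :
  central_diff (central_fact m.+1) = m.+1%:R *: central_fact m.
Proof.
rewrite /central_diff /central_fact !comp_polyM !comp_polyX !rmorph_prod /=.
(* [central_fact 0] is 1 and has no factor X, so m = 0 is treated apart. *)
case: m => [|m].
  rewrite !big_geq // !mulr1 scale1r polyCN opprD opprK addrACA subrr add0r.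
  by rewrite -polyCD; congr (_%:P).
set P := \prod_(1 <= j < m.+1) ('X + (m.+1%:R / 2%:R - j%:R)%:P).
(* The shift by 1/2 turns factor j into X + (m+1)/2 - (j-1): j = 1 gives the extra factor, the
   others form [P]. *)
have eqL : \prod_(1 <= j < m.+2)
    (('X + (m.+2%:R / 2%:R - j%:R)%:P) \Po ('X + (2%:R^-1)%:P)) =
    ('X + (m.+1%:R / 2%:R)%:P) * P :> {poly rat}.
  rewrite big_add1 /= big_nat_recl //= /P big_add1 /=; congr (_ * _).
    rewrite comp_polyD comp_polyX comp_polyC -addrA -polyCD.
    by congr (_ + _%:P); field.
  apply: eq_bigr => j _; rewrite comp_polyD comp_polyX comp_polyC -addrA -polyCD.
  by congr (_ + _%:P); field.
(* The shift by -1/2 gives X + (m+1)/2 - j, so here the extra factor is the last one, j = m+1. *)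
have eqR : \prod_(1 <= j < m.+2)
    (('X + (m.+2%:R / 2%:R - j%:R)%:P) \Po ('X + (- 2%:R^-1)%:P)) =
    ('X - (m.+1%:R / 2%:R)%:P) * P :> {poly rat}.
  rewrite big_nat_recr //= mulrC /P; congr (_ * _).
    rewrite comp_polyD comp_polyX comp_polyC -addrA -polyCD -polyCN.
    by congr (_ + _%:P); field.
  apply: eq_bigr => j _; rewrite comp_polyD comp_polyX comp_polyC -addrA -polyCD.
  by congr (_ + _%:P); field.
rewrite eqL eqR -mul_polyC.
(* With h = 1/2 and a = (m+1)/2, what remains is (X+h)(X+a) - (X-h)(X-a) = (2h+2a)X, times [P]. *)
have -> : (m.+2%:R : rat)%:P = (2%:R^-1)%:P + (2%:R^-1)%:P
    + (m.+1%:R / 2%:R)%:P + (m.+1%:R / 2%:R)%:P.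
  by rewrite -!polyCD; congr (_%:P); field.
rewrite polyCN; ring.
Qed.

Lemma central_fact_coef0 m : (central_fact m)`_0 = (m == 0%N)%:R.
Proof. by case: m => [|m]; rewrite /central_fact ?coef1 // coefXM. Qed.

Definition fps_two_sinh : fps := fps_sub (fps_exp 2%:R^-1) (fps_exp (- 2%:R^-1)).

Lemma fps_pair_two_sinh_mul (g : fps) (p : {poly rat}) :
  fps_pair (fps_mul fps_two_sinh g) p = fps_pair g (central_diff p).
Proof. by rewrite fps_pair_mul_subl !fps_pair_exp_mul -linearB. Qed.

(** Each step lowers k and m together; the base case reads off a constant term. *)
Lemma fps_pair_two_sinh_pow_fact k m :
  fps_pair (fps_pow fps_two_sinh k) (central_fact m) = k`!%:R * (m == k)%:R.
Proof.
elim: k m => [|k IHk] m; first by rewrite fps_pair_one central_fact_coef0 mul1r.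
rewrite /= fps_pair_two_sinh_mul; case: m => [|m].
  by rewrite central_diff_fact0 linear0 mulr0.
rewrite central_diff_factS linearZ_LR /= IHk eqSS.
by have [->|_] := eqVneq m k; rewrite ?mulr0 // !mulr1 factS natrM.
Qed.

Lemma fps_pair_two_sinh_powXn k l :
  fps_pair (fps_pow fps_two_sinh k) 'X^l = k`!%:R * central_fn2 l k.
Proof.
rewrite central_fn2E linear_sum /=.
under eq_bigr do rewrite linearZ_LR /= fps_pair_two_sinh_pow_fact.
have [ltkl|lelk] := ltnP k l.+1.
  rewrite (bigD1 (Ordinal ltkl)) //= eqxx mulr1 big1 ?addr0 1?mulrC //.
  by move=> i; rewrite -val_eqE /= => /negPf->; rewrite !mulr0.
(* For k > l no index equals k, and [central_fn2 l k] is 0 by default. *)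
rewrite big1 => [|i _].
  by rewrite /central_fn2 insubF ?mulr0 // ltnNge lelk.
by rewrite (ltn_eqF (leq_trans (ltn_ord i) lelk)) !mulr0.
Qed.

Theorem theorem2p2 (n k r : nat) (hkn : (k <= n)%N) :
  r_central_fn2 r (n + r)%N (k + r)%N =
  \sum_(k <= l < n.+1) 'C(n, l)%:R * central_fn2 l k * r%:R ^+ (n - l).
Proof.
rewrite /r_central_fn2 !addnK /r_central_egf /fps_scale mulrCA -fps_pairXn.
(* The swap makes the l-th binomial term carry X^l and r^(n-l). *)
rewrite fps_pair_exp_mulXn addrC exprDn linear_sum mulr_sumr /=.
under eq_bigr => l _.
  rewrite -polyC_exp mul_polyC linearMn linearZ_LR /= fps_pair_two_sinh_powXn.
  over.
pose F l := 'C(n, l)%:R * central_fn2 l k * r%:R ^+ (n - l) : rat.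
transitivity (\sum_(l < n.+1) F l).
  apply: eq_bigr => l _; rewrite /F -mulr_natl.
  have := fact_gt0 k; rewrite lt0n -(pnatr_eq0 rat) => k0.
  by field.
(* The terms with l < k vanish because [central_fn2 l k] is then 0. *)
rewrite -(big_mkord xpredT F) (@big_cat_nat _ _ _ k) //=; last exact: leqW.
rewrite big_nat big1 ?add0r // => l /andP[_ ltlk].
by rewrite /F /central_fn2 insubF ?mulr0 ?mul0r // ltnNge ltlk.
Qed.
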